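(* Let $n$ be a positive integer, let $r\ge 0$, let $a_1,\dots,a_{r+1}\in\mathbb{N}_0$ and let $c_1,\dots,c_r$ be integers with $c_j\ge 2$ for all $j$. Set $\mathbf{s}=(\{2\}^{a_1},c_1,\dots,\{2\}^{a_r},c_r,\{2\}^{a_{r+1}})$, let $\tilde{\mathbf{s}}=(2a_1,c_1,\dots,2a_r,c_r,2a_{r+1})$ be its condensation, and set $A_{n,k}=(-1)^{k-1}\binom{n}{k}/\binom{n+k}{k}$. Then $$H^\star_n(\mathbf{s})=2\sum_{I\subseteq[r]}\ \sum_{\substack{i_t+j_t+|\mathbf{x}_t|=c_t,\\ i_t\ge 1,\ j_t\ge 2\ \ \forall t\notin I}}2^{|\overline{I}|+\sum_{t\notin I}l(\mathbf{x}_t)}\ \sum_{k=1}^n\frac{H_{k-1}\big(\mathrm{Tr}(\kappa_I(\tilde{\mathbf{s}}))\big)\,A_{n,k}}{k^{\varphi(\kappa_I(\tilde{\mathbf{s}}))}}.$$ Here, for each $I\subseteq[r]$, the second sum runs over all choices, for every $t\in[r]\setminus I$, of integers $i_t\ge 1$, $j_t\ge 2$ and of a (possibly empty) finite sequence $\mathbf{x}_t$ of positive integers with $i_t+j_t+|\mathbf{x}_t|=c_t$.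
   Context: $\mathbb{N}_0$ is the set of non-negative integers and $[r]=\{1,\dots,r\}$ (so $[0]=\emptyset$). For a sequence $\mathbf{s}=(s_1,\dots,s_m)$ of positive integers and $n\ge 0$, $$H_n(\mathbf{s})=\sum_{n\ge k_1>\cdots>k_m\ge 1}\prod_{i=1}^m\frac{1}{k_i^{s_i}},\qquad H_n^\star(\mathbf{s})=\sum_{n\ge k_1\ge\cdots\ge k_m\ge 1}\prod_{i=1}^m\frac{1}{k_i^{s_i}},$$ with $H_n(\emptyset)=H^\star_n(\emptyset)=1$ and $H_n(\mathbf{s})=0$ if $n<m$. $\{2\}^a$ denotes the string of $a$ entries equal to $2$ (empty if $a=0$). For a finite sequence $\mathbf{x}=(x_1,\dots,x_m)$ of positive integers, $l(\mathbf{x})=m$ and $|\mathbf{x}|=x_1+\cdots+x_m$ (both $0$ if $\mathbf{x}=\emptyset$). For $I\subseteq[r]$ put $\overline{I}=[r]\setminus I$, and let $|\overline{I}|$ be its cardinality. The operation $\kappa_I=\sigma_{\overline I}\circ\mu_I$ acts on the condensation $\tilde{\mathbf{s}}=(2a_1,c_1,2a_2,\dots,2a_r,c_r,2a_{r+1})$, viewed as a string of symbols, as follows: for each $t\in I$ (merge $\mu_t$), the symbols ''$,c_t,$'' between $2a_t$ and $2a_{t+1}$ are replaced by ''$+c_t+$''; for each $t\in\overline{I}$ (substitution $\sigma_t$), the symbols ''$,c_t,$'' are replaced by ''$+j_t,\mathbf{x}_t,i_t+$'', where $i_t,j_t$ are integers and $\mathbf{x}_t$ is a finite (possibly empty) sequence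 of positive integers whose entries are inserted as separate components (if $\mathbf{x}_t=\emptyset$ the replacement is ''$+j_t,i_t+$''). For example, for $r=2$, $\kappa_{\{1,2\}}(\tilde{\mathbf{s}})=(2a_1+c_1+2a_2+c_2+2a_3)$, $\kappa_{\{1\}}(\tilde{\mathbf{s}})=(2a_1+c_1+2a_2+j_2,\mathbf{x}_2,i_2+2a_3)$, $\kappa_{\{2\}}(\tilde{\mathbf{s}})=(2a_1+j_1,\mathbf{x}_1,i_1+2a_2+c_2+2a_3)$, $\kappa_\emptyset(\tilde{\mathbf{s}})=(2a_1+j_1,\mathbf{x}_1,i_1+2a_2+j_2,\mathbf{x}_2,i_2+2a_3)$. For a sequence $\mathbf{e}=(e_1,\dots,e_m)$ with $m\ge 1$: $\varphi(\mathbf{e})=e_1$ is the first component, and $\mathrm{Tr}(\mathbf{e})=(e_2,\dots,e_m)$ is the truncation (with $\mathrm{Tr}(e_1)=\emptyset$). *)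

(* Defs.v *)
From mathcomp Require Import all_boot all_order all_algebra.
Set Implicit Arguments.
Unset Strict Implicit.
Unset Printing Implicit Defensive.
Import GRing.Theory.
Local Open Scope ring_scope.

(* Sums over tuples 1 <= k_i <= n with k_1 > ... > k_m, resp. k_1 >= ... >= k_m. *)
Definition H (n : nat) (s : seq nat) : rat :=
  \sum_(k : (size s).-tuple 'I_n.+1 |
          sorted gtn (map val k) && all (ltn 0) (map val k))
     \prod_(i < size s) ((tnth k i)%:R ^+ nth 0%N s i)^-1.

Definition Hstar (n : nat) (s : seq nat) : rat :=
  \sum_(k : (size s).-tuple 'I_n.+1 |
          sorted geq (map val k) && all (ltn 0) (map val k))
     \prod_(i < size s) ((tnth k i)%:R ^+ nth 0%N s i)^-1.

Definition A (n k : nat) : rat :=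
  (-1) ^+ k.-1 * 'C(n, k)%:R / 'C(n + k, k)%:R.

(* a_1, ..., a_{r+1} and c_1, ..., c_r are indexed from 0: a_t, a_{r+1} are
   [a (widen_ord (leqnSn r) t)] and [a ord_max]. *)
Definition arg_string (r : nat) (a : 'I_r.+1 -> nat) (c : 'I_r -> nat) :
    seq nat :=
  \big[cat/[::]]_(t < r)
      rcons (nseq (a (widen_ord (leqnSn r) t)) 2%N) (c t)
  ++ nseq (a ord_max) 2%N.

(* Triples (i, j, x), bounded by N so as to form a finite type; see
   [is_split_bounded] for why no solution of i + j + |x| = m, m <= N, is lost. *)
Notation split_box N := ('I_N.+1 * 'I_N.+1 * N.-bseq 'I_N.+1)%type.

Definition split_i N (d : split_box N) : nat := d.1.1.
Definition split_j N (d : split_box N) : nat := d.1.2.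
Definition split_x N (d : split_box N) : seq nat := map val d.2.

Definition is_split (m i j : nat) (x : seq nat) : bool :=
  [&& (1 <= i)%N, (2 <= j)%N, all (ltn 0) x & (i + j + sumn x == m)%N].

Definition split0 (N : nat) : split_box N := (ord0, ord0, [bseq]).

Definition bound (r : nat) (c : 'I_r -> nat) : nat := (\max_(t < r) c t)%N.

(* The families (i_t, j_t, x_t) indexed by t outside I: functions on 'I_r
   taking the dummy value [split0] on I. *)
Definition splits (r : nat) (c : 'I_r -> nat) (I : {set 'I_r}) :
    {pred {ffun 'I_r -> split_box (bound c)}} :=
  pfamily (split0 (bound c)) (mem (~: I))
    (fun t => [pred d | is_split (c t) (split_i d) (split_j d) (split_x d)]).
Arguments splits {r} c I.

(* Joins two strings of symbols by "+": (.., u) and (v, ..) give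
   (.., u + v, ..). *)
Fixpoint glue (e f : seq nat) : seq nat :=
  match e, f with
  | [::], _ => f
  | [:: u], v :: f' => (u + v)%N :: f'
  | u :: e', _ => u :: glue e' f
  end.

(* What stands between "2a_t +" and "+ 2a_{t+1}" after applying kappa_I. *)
Definition block (r : nat) (c : 'I_r -> nat) (I : {set 'I_r})
    (w : {ffun 'I_r -> split_box (bound c)}) (t : 'I_r) : seq nat :=
  if t \in I then [:: c t]
  else split_j (w t) :: rcons (split_x (w t)) (split_i (w t)).
Arguments block {r} c I w t.

Definition kappa (r : nat) (a : 'I_r.+1 -> nat) (c : 'I_r -> nat)
    (I : {set 'I_r}) (w : {ffun 'I_r -> split_box (bound c)}) : seq nat :=
  glue (\big[glue/[::]]_(t < r)
          glue [:: (2 * a (widen_ord (leqnSn r) t))%N] (block c I w t))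
       [:: (2 * a ord_max)%N].
Arguments kappa {r} a c I w.

Lemma is_split_bounded (N m i j : nat) (x : seq nat) :
  (m <= N)%N -> is_split m i j x ->
  exists d : split_box N, [/\ split_i d = i, split_j d = j & split_x d = x].
Proof.
move=> mN /and4P[i1 j2 xpos /eqP def_m].
have szx : (size x <= sumn x)%N.
  elim: x xpos {def_m} => //= y x IHx /andP[y0 /IHx].
  by rewrite -[(size x).+1]add1n; apply: leq_add.
have lex : (sumn x <= N)%N by rewrite (leq_trans _ mN) // -def_m leq_addl.
have allx : all (fun y => (y <= N)%N) x.
  apply/allP=> y /(nthP 0%N)[k ltk <-]; apply: leq_trans lex.
  elim: x k ltk {xpos def_m szx} => //= z x IHx [|k] ltk /=; first exact: leq_addr.
  by rewrite (leq_trans (IHx _ ltk)) ?leq_addl.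
have szN : (size (map (@inord N) x) <= N)%N.
  by rewrite size_map (leq_trans szx).
have iN : (i < N.+1)%N by rewrite ltnS (leq_trans _ mN) // -def_m -addnA leq_addr.
have jN : (j < N.+1)%N.
  by rewrite ltnS (leq_trans _ mN) // -def_m addnAC leq_addl.
exists (Ordinal iN, Ordinal jN, Bseq szN); split=> //.
rewrite /split_x /= -map_comp -[RHS]map_id.
apply/eq_in_map=> y /(allP allx) yN /=.
by rewrite inordK.
Qed.

(* Main.v *)
(* Say that f represents s if Hstar n s = 2 \sum_(1 <= k <= n) A n k * f k for all
   n > 0. The tail sums of A n telescope,
     \sum_(k > l) A n k = A n l * (l - n) / (2 n),
   so dividing \sum_k A n k * f k by n amounts to replacing f by T f, where
     T f k = f k / k + 2 \sum_(l < k) f l / l.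
   Together with A n k - A (n - 1) k = A n k * k^2 / n^2, this shows that if f
   represents s, then k |-> (T^m f) k / k^2 represents (m + 2, s). Let D be
   division by k and S strict summation, so that T = D + 2 S D. The words in the
   expansion of D^2 T^m are indexed by the compositions of m + 2 with first part
   at least 2: the word D^(m + 2) is a merge, and D^j S D^x1 S ... S D^i is a
   substitution (j, x, i), with a factor 2 for each letter S. *)
Require Import Defs.
From mathcomp Require Import all_boot all_order all_algebra.
From mathcomp Require Import zify ring.
Import GRing.Theory Num.Theory.
Local Open Scope ring_scope.

(** * Harmonic sums as nested sums *)

Lemma big_tupleS (R : Type) (idx : R) (op : Monoid.com_law idx) (T : finType)
    (m : nat) (P : pred (m.+1.-tuple T)) (F : m.+1.-tuple T -> R) :
  \big[op/idx]_(k | P k) F k =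
  \big[op/idx]_(x : T) \big[op/idx]_(k : m.-tuple T | P [tuple of x :: k])
    F [tuple of x :: k].
Proof.
rewrite pair_big_dep.
rewrite (reindex (fun p : T * m.-tuple T => [tuple of p.1 :: p.2])) //.
exists (fun k => (thead k, [tuple of behead k])) => [[x k]|k] _ /=.
  by rewrite theadE; congr pair; apply: val_inj.
by rewrite -tuple_eta.
Qed.

(** [H] and [Hstar] are the cases [sorted gtn] and [sorted geq]; a general [P] leaves room for
    [path r l], where [l] is the index chosen just before. *)
Definition chain_sum (N : nat) (P : pred (seq nat)) (s : seq nat) : rat :=
  \sum_(k : (size s).-tuple 'I_N.+1 | P (map val k) && all (ltn 0) (map val k))
     \prod_(i < size s) ((tnth k i)%:R ^+ nth 0%N s i)^-1.

Lemma eq_chain_sum N (P Q : pred (seq nat)) s :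
    (forall k, all (geq N) k -> P k = Q k) ->
  chain_sum N P s = chain_sum N Q s.
Proof.
move=> eqPQ; apply: eq_bigl => k; congr (_ && _); apply: eqPQ.
by apply/allP=> _ /mapP[x _ ->] /=; rewrite -ltnS.
Qed.

Lemma chain_sum_cons N (r : rel nat) l x s :
  chain_sum N (path r l) (x :: s) =
  \sum_(1 <= k < N.+1 | r l k) (k%:R ^+ x)^-1 * chain_sum N (path r k) s.
Proof.
rewrite /chain_sum big_tupleS /= [RHS]big_mkcond big_add1 /= big_mkord.
(* The index 0 fails the positivity condition. *)
rewrite big_ord_recl big1 ?add0r /= => [|ks]; last by rewrite andbF.
apply: eq_bigr => k _; rewrite /bump add1n.
case: (boolP (r l k.+1)) => rlk; last first.
  by rewrite big1 // => ks; rewrite /= /bump add1n (negbTE rlk).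
rewrite big_distrr; apply: eq_big => [ks|ks _] //.
rewrite big_ord_recl; congr (_ * _); apply: eq_bigr => i _.
by congr (_%:R ^- _); congr nat_of_ord; exact: tnthS.
Qed.

Lemma chain_sum_nil N (P : pred (seq nat)) : P [::] -> chain_sum N P [::] = 1.
Proof.
move=> P0; rewrite /chain_sum (big_pred1 [tuple]) ?big_ord0 // => k.
by rewrite (tuple0 k) /= P0 eqxx.
Qed.

(* The bound [u l] is [l] for strictly and [l.+1] for weakly decreasing indices. *)
Fixpoint nested_sum (u : nat -> nat) (l : nat) (s : seq nat) : rat :=
  if s is x :: s' then
    \sum_(1 <= k < u l) (k%:R ^+ x)^-1 * nested_sum u k s'
  else 1.

(** Tuples live in a box of fixed size while the nested ranges shrink; the bounds on [u] keep every
    range inside the box. *)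
Lemma chain_sum_nested N (u : nat -> nat) (r : rel nat) l s :
    (forall k j, r k j = (j < u k)%N) ->
    {in [pred k | (k <= N)%N], forall k, (u k <= N.+1)%N} -> (u l <= N.+1)%N ->
  chain_sum N (path r l) s = nested_sum u l s.
Proof.
move=> def_r leu; elim: s l => [|x s IHs] l lel; first exact: chain_sum_nil.
rewrite chain_sum_cons [RHS]/=.
rewrite [RHS](@big_nat_widen _ _ _ 1 (u l) N.+1) // [LHS]big_nat_cond [RHS]big_nat_cond.
apply: eq_big => [k|k /andP[/andP[_ ltk] _]]; first by rewrite def_r.
by rewrite IHs //; apply: leu.
Qed.

(** A virtual index before k_1 turns [sorted] into [path]: it is n + 1 in the strict case and n in
    the weak one, so that it only demands k_1 <= n. *)
Lemma H_nested n s : H n s = nested_sum id n.+1 s.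
Proof.
rewrite -(@chain_sum_nested n id gtn) // => [|k]; last exact: leqW.
by apply: eq_chain_sum => -[|k ks] //= /andP[lekn _]; rewrite ?ltnS lekn.
Qed.

Lemma Hstar_nested n s : Hstar n s = nested_sum S n s.
Proof.
rewrite -(@chain_sum_nested n S geq) //.
by apply: eq_chain_sum => -[|k ks] //= /andP[lekn _]; rewrite ?ltnS lekn.
Qed.

Lemma H_nil n : H n [::] = 1.
Proof. by rewrite H_nested. Qed.

Lemma H_cons n x s :
  H n (x :: s) = \sum_(1 <= k < n.+1) H k.-1 s / k%:R ^+ x.
Proof.
rewrite H_nested /= !big_add1; apply: eq_bigr => k _.
by rewrite H_nested mulrC.
Qed.

Lemma Hstar_nil n : Hstar n [::] = 1.
Proof. by rewrite Hstar_nested. Qed.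

Lemma Hstar_cons n x s :
  Hstar n (x :: s) = \sum_(1 <= k < n.+1) Hstar k s / k%:R ^+ x.
Proof.
rewrite Hstar_nested; apply: eq_bigr => k _.
by rewrite Hstar_nested mulrC.
Qed.

(** * The kernel A: differences, tail sums, adjoint of division by n *)

Lemma binR_neq0 n m : (m <= n)%N -> 'C(n, m)%:R != 0 :> rat.
Proof. by move=> lemn; rewrite pnatr_eq0 -lt0n bin_gt0. Qed.

Lemma A_top n : A n n.+1 = 0.
Proof. by rewrite /A bin_small // mulr0 mul0r. Qed.

(** The two binomial ratios are (n + 1 - k) / (n + 1) and (n + 1 + k) / (n + 1), so that A n k = A
    (n + 1) k * (1 - k^2 / (n + 1)^2). *)
Lemma A_step n k :
  A n.+1 k - A n k = A n.+1 k * k%:R ^+ 2 / n.+1%:R ^+ 2.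
Proof.
have [ltnk|lekn] := ltnP n.+1 k.
  rewrite /A (@bin_small n.+1 k) // (@bin_small n k) ?(ltnW ltnk) //.
  by rewrite !mulr0 !mul0r subr0.
have num : n.+1%:R * 'C(n, k)%:R = (n.+1%:R - k%:R) * 'C(n.+1, k)%:R :> rat.
  by rewrite -natrB // -!natrM -mul_bin_down.
have den : (n.+1 + k)%:R * 'C(n + k, k)%:R
             = n.+1%:R * 'C(n.+1 + k, k)%:R :> rat.
  by rewrite -!natrM -[X in 'C(X, _)]/((n.+1 + k).-1) mul_bin_down addnK.
have n0 : n.+1%:R != 0 :> rat by rewrite pnatr_eq0.
have d0 : 'C(n + k, k)%:R != 0 :> rat by rewrite binR_neq0 ?leq_addl.
have {}num : 'C(n, k)%:R = (n.+1%:R - k%:R) * 'C(n.+1, k)%:R / n.+1%:R :> rat.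
  by rewrite -num mulrAC divff ?mul1r.
have {}den : 'C(n.+1 + k, k)%:R = (n.+1%:R + k%:R) * 'C(n + k, k)%:R / n.+1%:R :> rat.
  by rewrite -natrD den mulrAC divff ?mul1r.
have s0 : n.+1%:R + k%:R != 0 :> rat by rewrite -natrD pnatr_eq0.
rewrite /A num den; move: (n.+1%:R : rat) n0 s0 {num den} => x n0 s0; field.
by rewrite n0 d0 s0.
Qed.

(** For l > 0 the right side is A n l * (l - n) / (2 n). The sign (-1)^l covers l = 0 as well, where
    the predecessor in [A] gives the wrong sign. The upper boundary term of the telescoping sum
    vanishes through its factor n - n. *)
Lemma A_tail n l : (l <= n)%N -> (0 < n)%N ->
  \sum_(l <= k < n) A n k.+1 =
  (-1) ^+ l * 'C(n, l)%:R / 'C(n + l, l)%:R * (n%:R - l%:R) / (2 * n%:R).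
Proof.
move=> leln n_gt0.
pose g k : rat :=
  - ((-1) ^+ k * 'C(n, k)%:R / 'C(n + k, k)%:R * (n%:R - k%:R) / (2 * n%:R)).
rewrite (telescope_sumr_eq g) // => [|k /andP[_ ltkn]].
  by rewrite /g subrr mulr0 mul0r oppr0 sub0r opprK.
have num : k.+1%:R * 'C(n, k.+1)%:R = (n%:R - k%:R) * 'C(n, k)%:R :> rat.
  by rewrite -natrB ?(ltnW ltkn) // -!natrM mul_bin_left.
have den : (n%:R + k.+1%:R) * 'C(n + k, k)%:R
             = k.+1%:R * 'C(n + k.+1, k.+1)%:R :> rat.
  by rewrite -natrD -!natrM -mul_bin_diag addnS.
have n0 : n%:R != 0 :> rat by rewrite pnatr_eq0 -lt0n.
have k0 : k.+1%:R != 0 :> rat by rewrite pnatr_eq0.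
have s0 : n%:R + k.+1%:R != 0 :> rat by rewrite -natrD pnatr_eq0 addnS.
have d0 : 'C(n + k, k)%:R != 0 :> rat by rewrite binR_neq0 ?leq_addl.
have {}num : 'C(n, k.+1)%:R = (n%:R - k%:R) * 'C(n, k)%:R / k.+1%:R :> rat.
  by rewrite -num mulrAC divff ?mul1r.
have {}den : 'C(n + k.+1, k.+1)%:R
                = (n%:R + k.+1%:R) * 'C(n + k, k)%:R / k.+1%:R :> rat.
  by rewrite den mulrAC divff ?mul1r.
rewrite /A /g num den exprS -pred_Sn; move: k0 s0; rewrite -[k.+1%:R]natr1 => k0 s0.
field.
by rewrite n0 d0 s0 k0.
Qed.

Lemma A_sum n : (0 < n)%N -> 2%:R * \sum_(1 <= k < n.+1) A n k = 1.
Proof.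
move=> n_gt0; rewrite big_add1 A_tail // bin0 addn0 bin0 subr0.
have n0 : n%:R != 0 :> rat by rewrite pnatr_eq0 -lt0n.
by field.
Qed.

(* The adjoint of division by [n] for the pairing [\sum_k A n k * f k]. *)
Definition divn_adj (f : nat -> rat) (k : nat) : rat :=
  f k / k%:R + 2%:R * \sum_(1 <= l < k) f l / l%:R.

(** After exchanging the sums, f l / l has on the right the coefficient A n l + 2 \sum_(k > l) A n k
    = A n l + A n l * (l - n) / n = A n l * l / n. *)
Lemma A_sum_divn_adj n f : (0 < n)%N ->
  (\sum_(1 <= k < n.+1) A n k * f k) / n%:R = \sum_(1 <= k < n.+1) A n k * divn_adj f k.
Proof.
move=> n_gt0; have n0 : n%:R != 0 :> rat by rewrite pnatr_eq0 -lt0n.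
under [RHS]eq_bigr do rewrite mulrDr.
rewrite big_split /=.
have -> : \sum_(1 <= k < n.+1) A n k * (2%:R * \sum_(1 <= l < k) f l / l%:R)
   = \sum_(1 <= l < n.+1) 2%:R * (f l / l%:R) * \sum_(l <= k < n) A n k.+1.
  under eq_big_nat => k /andP[_ ltk].
    rewrite (big_nat_widen _ _ _ _ _ (ltnW ltk)) big_distrr big_distrr /=; over.
  rewrite (exchange_big_dep_nat xpredT) //=; apply: eq_big_nat => l /andP[l0 _].
  rewrite -(big_add1 _ _ _ n.+1 xpredT) (big_nat_widenl l.+1 1) // big_distrr /=.
  apply: eq_bigr => k _; ring.
rewrite big_distrl -big_split /=; apply: eq_big_nat => l /andP[l0 len].
have l0' : l%:R != 0 :> rat by rewrite pnatr_eq0 -lt0n.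
rewrite A_tail // /A -[in (-1) ^+ l](prednK l0) exprS.
have d0 : 'C(n + l, l)%:R != 0 :> rat by rewrite binR_neq0 ?leq_addl.
by field; rewrite n0 l0' d0.
Qed.

Lemma A_sum_iter_divn_adj n f m : (0 < n)%N ->
  (\sum_(1 <= k < n.+1) A n k * f k) / n%:R ^+ m
    = \sum_(1 <= k < n.+1) A n k * iter m divn_adj f k.
Proof.
move=> n_gt0; elim: m => [|m IHm]; first by rewrite divr1.
by rewrite iterS -A_sum_divn_adj // -IHm exprSr invfM mulrA.
Qed.

(** * Star sums represented by functions of k *)

Definition represents (f : nat -> rat) (s : seq nat) : Prop :=
  forall n, (0 < n)%N -> Hstar n s = 2%:R * \sum_(1 <= k < n.+1) A n k * f k.

Lemma represents_nil : represents (fun=> 1) [::].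
Proof.
by move=> n n0; under eq_bigr do rewrite mulr1; rewrite A_sum // Hstar_nil.
Qed.

(** Compare increments in n: the k^2 of [A_step] cancels the division by k^2 and leaves (n + 1)^-2,
    while the iterated adjoint accounts for (n + 1)^-c. *)
Lemma represents_cons f c s : represents f s ->
  represents (fun k => iter c divn_adj f k / k%:R ^+ 2) (c.+2 :: s).
Proof.
(* The induction can start at n = 0, where both sums are empty; [fs] is only used at n + 1. *)
move=> fs n _; rewrite Hstar_cons; elim: n => [|n IHn].
  by rewrite !big_geq // mulr0.
rewrite big_nat_recr //= {}IHn fs //.
(* Both sums over k get the same range, since A n (n + 1) = 0. *)
have -> : \sum_(1 <= k < n.+1) A n k * (iter c divn_adj f k / k%:R ^+ 2) =
          \sum_(1 <= k < n.+2) A n k * (iter c divn_adj f k / k%:R ^+ 2).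
  by rewrite [RHS]big_nat_recr //= A_top mul0r addr0.
rewrite -mulrA -mulrDr; congr (_ * _).
have -> : n.+1%:R ^+ c.+2 = n.+1%:R ^+ c * n.+1%:R ^+ 2 :> rat.
  by rewrite -exprD addn2.
rewrite invfM mulrA A_sum_iter_divn_adj // big_distrl -big_split /=.
apply: eq_big_nat => k /andP[k0 _].
have k0' : k%:R != 0 :> rat by rewrite pnatr_eq0 -lt0n.
rewrite -[in RHS](subrK (A n k) (A n.+1 k)) A_step.
have n0' : n.+1%:R != 0 :> rat by rewrite pnatr_eq0.
by move: (n.+1%:R : rat) n0' => x x0; field; rewrite k0'.
Qed.

(** * Words in D and S, and the expansion of the iterated adjoint *)

(** For e = (e_1, ..., e_m) this is the word D^e_1 S D^e_2 S ... S D^e_m applied to the constant 1.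
    On nonempty e, [incr_head] is a further D and prepending 0 a further S. *)
Definition term (e : seq nat) (k : nat) : rat :=
  H k.-1 (behead e) / k%:R ^+ head 0%N e.

Definition incr_head (e : seq nat) : seq nat :=
  if e is j :: x then j.+1 :: x else [::].

Lemma size_incr_head e : size (incr_head e) = size e.
Proof. by case: e. Qed.

Lemma incr_head_inj : injective incr_head.
Proof. by case=> [|j x] [|j' x'] //= [-> ->]. Qed.

Lemma glue_eq0 e f : (glue e f == [::]) = (e == [::]) && (f == [::]).
Proof. by case: e f => [|u [|u' e]] [|v f]. Qed.

Lemma glue_cons u b e : b != [::] -> glue (u :: b) e = u :: glue b e.
Proof. by case: b. Qed.

Lemma glueA : associative glue.
Proof.
elim=> [|u [|u' e] IHe] f g //; last first.
  rewrite (glue_cons u (u' :: e) f) // (glue_cons u (u' :: e) (glue f g)) // IHe.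
  by rewrite (glue_cons u (glue (u' :: e) f)) // glue_eq0.
by case: f g => [|v [|v' f]] [|w g] //=; rewrite addnA.
Qed.

Lemma glue_incr_head b e : b != [::] -> e != [::] ->
  glue (incr_head b) e = incr_head (glue b e).
Proof. by case: b e => [|u [|u' b]] [|v e]. Qed.

Local Arguments glue e f : simpl never.

Lemma term_incr_head e k : e != [::] -> term (incr_head e) k = term e k / k%:R.
Proof. by case: e => // j x _; rewrite /term /= exprSr invfM mulrA. Qed.

Lemma term_cons0 e k : e != [::] -> term (0%N :: e) k = \sum_(1 <= l < k) term e l.
Proof.
case: e => // j x _; rewrite /term /= expr0 divr1 H_cons.
by case: k => [|k] //=; rewrite !big_geq.
Qed.

Lemma eq_divn_adj f g : f =1 g -> divn_adj f =1 divn_adj g.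
Proof.
by move=> eqfg k; rewrite /divn_adj eqfg; under eq_bigr do rewrite eqfg.
Qed.

Lemma divn_adj_sum (I : Type) (s : seq I) (w : I -> rat) (f : I -> nat -> rat) k :
  divn_adj (fun k => \sum_(i <- s) w i * f i k) k
    = \sum_(i <- s) w i * divn_adj (f i) k.
Proof.
rewrite /divn_adj; under [RHS]eq_bigr do rewrite mulrDr mulrA mulrCA big_distrr /=.
rewrite big_split -big_distrl -big_distrr exchange_big /=; congr (_ + _ * _).
apply: eq_bigr => l _; rewrite big_distrl; apply: eq_bigr => i _.
by rewrite mulrA.
Qed.

Lemma iter_divn_adj_sum (I : Type) (s : seq I) (w : I -> rat) (f : I -> nat -> rat)
    m k :
  iter m divn_adj (fun k => \sum_(i <- s) w i * f i k) k
    = \sum_(i <- s) w i * iter m divn_adj (f i) k.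
Proof.
elim: m k => //= m IHm k.
by rewrite (eq_divn_adj _ _ IHm) divn_adj_sum.
Qed.

Lemma divn_adj_term e k : e != [::] ->
  divn_adj (term e) k = term (incr_head e) k + 2%:R * term (0%N :: incr_head e) k.
Proof.
move=> e0; have ie0 : incr_head e != [::] by case: e e0.
rewrite term_cons0 // term_incr_head //; congr (_ + _ * _).
by apply: eq_bigr => l _; rewrite term_incr_head.
Qed.

(* Compositions of [m] whose first entry may be [0]. *)
Fixpoint weak_comps (m : nat) : seq (seq nat) :=
  if m is m'.+1 then
    [seq incr_head b | b <- weak_comps m'] ++
    [seq 0%N :: incr_head b | b <- weak_comps m']
  else [:: [:: 0%N]].

Lemma mem_weak_comps m b :
  (b \in weak_comps m) =
  [&& b != [::], all (ltn 0) (behead b) & sumn b == m].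
Proof.
elim: m b => [|m IHm] b.
  by rewrite inE; case: b => [|[|j] [|[|y] x]] //=; rewrite ?andbF.
rewrite [weak_comps _]/= mem_cat; apply/orP/idP => [[]|].
- case/mapP=> -[|j x]; rewrite IHm //= => /andP[posx /eqP<-] ->.
  by rewrite /= posx addSn eqxx.
- case/mapP=> -[|j x]; rewrite IHm //= => /andP[posx /eqP<-] ->.
  by rewrite /= posx addSn eqxx.
(* If the first entry is 0, remove it and lower the next one, which is positive; otherwise lower the
   first entry. *)
case: b => [|[|j] x] //= /andP[posx /eqP sumx].
- case: x posx sumx => [|[|y] x] //= posx [sumx]; right.
  by apply/mapP; exists (y :: x) => //; rewrite IHm /= posx; apply/eqP.
- left; apply/mapP; exists (j :: x) => //; rewrite IHm /= posx.
  by case: sumx => ->; apply/eqP.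
Qed.

Lemma weak_comps_uniq m : uniq (weak_comps m).
Proof.
elim: m => //= m IHm; rewrite cat_uniq !map_inj_uniq ?IHm //; last first.
- exact: incr_head_inj.
- by move=> b b' [/incr_head_inj].
rewrite andbT; apply/hasPn => _ /mapP[b _ ->].
by apply/mapP => -[[|j x]].
Qed.

(** Each factor D + 2 S D either raises the first entry of b or also opens a new one at the cost of
    a 2. The last D's of b meet the first D's of e, hence [glue]. *)
Lemma iter_divn_adj_term m e k : e != [::] ->
  iter m divn_adj (term e) k =
  \sum_(b <- weak_comps m) 2%:R ^+ (size b).-1 * term (glue b e) k.
Proof.
move=> e0; elim: m k => [|m IHm] k.
  by rewrite big_seq1 /= expr0 mul1r; case: e e0.
rewrite iterS (eq_divn_adj _ _ IHm) divn_adj_sum /= big_cat !big_map /= -big_split /=.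
rewrite !big_seq; apply: eq_bigr => b; rewrite mem_weak_comps => /and3P[b0 _ _].
have ib0 : incr_head b != [::] by case: b b0.
rewrite divn_adj_term ?glue_eq0 ?negb_and ?b0 // glue_cons // glue_incr_head //.
rewrite size_incr_head mulrDr; congr (_ + _).
by case: b b0 {ib0} => //= j x _; rewrite mulrA -exprSr.
Qed.

(* The compositions of [c] with first entry at least [2]: the singleton is a
   merge, the longer ones [(j, x, i)] are the substitutions. *)
Definition blocks (c : nat) : seq (seq nat) :=
  [seq incr_head (incr_head b) | b <- weak_comps (c - 2)].

Lemma mem_blocks c b : (2 <= c)%N ->
  (b \in blocks c) =
  [&& (2 <= head 0 b)%N, all (ltn 0) (behead b) & sumn b == c].
Proof.
case: c => [|[|c]] // _; rewrite /blocks subn2 /=; apply/mapP/idP.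
- case=> -[|j x]; rewrite mem_weak_comps //= => /andP[posx /eqP<-] ->.
  by rewrite /= posx !addSn eqxx.
case: b => [|[|[|j]] x] //= /andP[posx /eqP [sumx]].
by exists (j :: x); rewrite // mem_weak_comps /= posx; apply/eqP.
Qed.

Lemma blocks_uniq c : uniq (blocks c).
Proof.
by rewrite map_inj_uniq ?weak_comps_uniq // => b b' /incr_head_inj/incr_head_inj.
Qed.

(** * Families of blocks and the expansion of the whole string *)

Fixpoint families (cs : seq nat) : seq (seq (seq nat)) :=
  if cs is c :: cs' then
    [seq b :: bs | b <- blocks c, bs <- families cs']
  else [:: [::]].

Lemma mem_families cs bs :
  (bs \in families cs) = all2 (fun b c => b \in blocks c) bs cs.
Proof.
elim: cs bs => [|c cs IHcs] [|b bs] //=; rewrite -?IHcs.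
- by apply/allpairsP => -[[? ?] []].
- apply/allpairsP/andP => [[[b' bs'] [? ? [-> ->]]] //|[bc bscs]].
  by exists (b, bs).
Qed.

Lemma families_uniq cs : uniq (families cs).
Proof.
elim: cs => //= c cs IHcs; rewrite allpairs_uniq ?blocks_uniq //.
by move=> [b bs] [b' bs'] _ _ /= [-> ->].
Qed.

(** The number of letters S: a merge contributes 0, a substitution (j, x, i) contributes l(x) +
    1. *)
Definition weight (bs : seq (seq nat)) : nat := \sum_(b <- bs) (size b).-1.

Lemma eq_represents f g s : f =1 g -> represents f s -> represents g s.
Proof.
by move=> eqfg fs n n0; rewrite fs //; under eq_bigr do rewrite eqfg.
Qed.

(** This is [represents_cons] with c = 0: no adjoint is applied, so a leading 2 does not branch and
    only adds 2 to the first exponent. *)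
Lemma represents_twos (I : eqType) (t : seq I) (w : I -> rat) (e : I -> seq nat) a s :
    {in t, forall i, e i != [::]} ->
    represents (fun k => \sum_(i <- t) w i * term (e i) k) s ->
  represents (fun k => \sum_(i <- t) w i * term (glue [:: 2 * a]%N (e i)) k)
    (nseq a 2%N ++ s).
Proof.
move=> e0 ts; elim: a => [|a IHa] /=.
  apply: eq_represents ts => k; rewrite !big_seq; apply: eq_bigr => i /e0.
  by case: (e i).
apply: eq_represents (represents_cons _ 0%N _ IHa) => k /=.
rewrite big_distrl !big_seq; apply: eq_bigr => i /e0.
case: (e i) => //= j x _; rewrite /term /= -!mulrA -invfM -exprD.
congr (_ * (_ * (_ ^+ _)^-1)); lia.
Qed.

Section Strings.
Variable al : nat.

(** Strings built from lists, for induction from the left; [al] plays the role of a_{r+1}. *)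
Fixpoint twos_string (aas cs : seq nat) : seq nat :=
  match aas, cs with
  | a :: aas', c :: cs' => nseq a 2%N ++ c :: twos_string aas' cs'
  | _, _ => nseq al 2%N
  end.

Fixpoint glue_family (aas : seq nat) (bs : seq (seq nat)) : seq nat :=
  match aas, bs with
  | a :: aas', b :: bs' => glue (glue [:: 2 * a]%N b) (glue_family aas' bs')
  | _, _ => [:: 2 * al]%N
  end.

Lemma glue_family_neq0 aas bs : glue_family aas bs != [::].
Proof.
by elim: aas bs => [|a aas IHa] [|b bs] //=; rewrite glue_eq0 negb_and IHa orbT.
Qed.

Lemma represents_family aas cs :
    size aas = size cs -> all (leq 2) cs ->
  represents
    (fun k => \sum_(bs <- families cs)
       2%:R ^+ weight bs * term (glue_family aas bs) k)
    (twos_string aas cs).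
Proof.
elim: aas cs => [|a aas IHa] [|c cs] //=.
  (* The constant 1 is [term [:: 0]], so the last run of twos is handled like the others, with a
     one-element index list. *)
  move=> _ _; rewrite -[nseq al _]cats0.
  have := @represents_twos _ [:: tt] (fun=> 1) (fun=> [:: 0%N]) al [::].
  move=> /(_ (fun _ _ => isT)) tw; apply: eq_represents (tw _) => [k|].
    by rewrite !big_seq1 /weight big_nil /= /glue addn0.
  apply: eq_represents represents_nil => k.
  by rewrite big_seq1 /term /= H_nil expr0 divr1.
case=> /IHa{}IHa /andP[c2 /IHa{}IHa].
pose t := [seq (b, bs) | b <- blocks c, bs <- families cs].
pose w p : rat := 2%:R ^+ weight (p.1 :: p.2).
pose e p := glue p.1 (glue_family aas p.2).
have e0 : {in t, forall p, e p != [::]}.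
  by move=> p _; rewrite glue_eq0 negb_and glue_family_neq0 orbT.
have tw : represents (fun k => \sum_(p <- t) w p * term (e p) k)
                     (c :: twos_string aas cs).
  case: c c2 @t e0 => [|[|c]] // _ t e0.
  apply: eq_represents (represents_cons _ c _ IHa) => k.
  rewrite iter_divn_adj_sum big_allpairs_dep /= /blocks subn2 big_map exchange_big /=.
  rewrite big_distrl; apply: eq_bigr => bs _.
  rewrite iter_divn_adj_term ?glue_family_neq0 // big_distrr big_distrl /=.
  rewrite !big_seq; apply: eq_bigr => b; rewrite mem_weak_comps => /andP[b0 _].
  have ib0 : incr_head b != [::] by case: b b0.
  (* The two [incr_head] that make a block from a weak composition are the division by k^2 in
     [represents_cons]. *)
  rewrite /w /e /weight /= big_cons !size_incr_head exprD.
  rewrite !glue_incr_head ?glue_family_neq0 //.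
  have gb0 : glue b (glue_family aas bs) != [::].
    by rewrite glue_eq0 negb_and b0.
  rewrite !term_incr_head //; last by case: (glue b _) gb0.
  rewrite (expr2 k%:R) invfM; ring.
apply: eq_represents (represents_twos _ _ _ _ a _ e0 tw) => k.
by rewrite !big_allpairs_dep; under [RHS]eq_bigr do under eq_bigr do rewrite -glueA.
Qed.

End Strings.

Lemma twos_string_map (I : Type) al (f g : I -> nat) (l : seq I) :
  twos_string al (map f l) (map g l) =
  \big[cat/[::]]_(t <- l) rcons (nseq (f t) 2%N) (g t) ++ nseq al 2%N.
Proof.
elim: l => [|t l IHl] /=; first by rewrite big_nil.
by rewrite big_cons -catA -IHl cat_rcons.
Qed.

Lemma glue_family_map (I : Type) al (f : I -> nat) (g : I -> seq nat) (l : seq I) :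
  glue_family al (map f l) (map g l) =
  glue (\big[glue/[::]]_(t <- l) glue [:: 2 * f t]%N (g t)) [:: 2 * al]%N.
Proof.
elim: l => [|t l IHl] /=; first by rewrite big_nil.
by rewrite big_cons -[RHS]glueA -IHl.
Qed.

(** As [l] has no repetition, a list of blocks along [l] can be read as the values of a function of
    the index. *)
Lemma mem_families_map (I : eqType) (c : I -> nat) (l : seq I) bs :
    uniq l -> bs \in families (map c l) ->
  exists2 g : I -> seq nat, bs = map g l & {in l, forall t, g t \in blocks (c t)}.
Proof.
rewrite mem_families; elim: l bs => [|t l IHl] [|b bs] //=.
  by exists (fun=> [::]).
case/andP=> tl uniq_l /andP[bt /(IHl _ uniq_l)[g -> gP]].
exists (fun u => if u == t then b else g u).
  rewrite eqxx; congr (_ :: _); apply/eq_in_map => u ul.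
  by case: eqP ul tl => // -> ->.
move=> u; rewrite inE; case: eqP => [-> //|_] /=; exact: gP.
Qed.

Lemma families_map_mem (I : eqType) (c : I -> nat) (g : I -> seq nat) (l : seq I) :
  {in l, forall t, g t \in blocks (c t)} -> map g l \in families (map c l).
Proof.
rewrite mem_families; elim: l => //= t l IHl gP.
by rewrite gP ?mem_head // IHl // => u ul; rewrite gP // inE ul orbT.
Qed.

(** * Pairs (I, w) correspond to families of blocks *)

Section Blocks.
Variables (r : nat) (c : 'I_r -> nat).
Hypothesis c_ge2 : forall t, (2 <= c t)%N.
Implicit Types (I : {set 'I_r}) (w : {ffun 'I_r -> split_box (bound c)}).

Lemma splitsP I w :
  reflect (forall t, if t \in I then w t = split0 (bound c)
           else is_split (c t) (split_i (w t)) (split_j (w t)) (split_x (w t)))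
          (w \in splits c I).
Proof.
apply: (iffP pfamilyP) => [[/subsetP supp wP] t|wP].
  case: ifP => [tI|/negbT tI]; last by apply: wP; rewrite inE.
  by apply/eqP/negPn/negP => /supp; rewrite inE tI.
split=> [|t]; last by rewrite inE => tI; have:= wP t; rewrite (negbTE tI).
apply/subsetP => t; rewrite inE => wt; rewrite inE.
by apply/negP => tI; move: (wP t); rewrite tI; apply/eqP.
Qed.

Lemma block_in_blocks I w t : w \in splits c I -> block c I w t \in blocks (c t).
Proof.
move=> /splitsP/(_ t); rewrite /block mem_blocks //; case: ifP => _ => [_|].
  by rewrite /= c_ge2 addn0 eqxx.
case/and4P=> i1 j2 posx /eqP<- /=.
rewrite j2 all_rcons /= i1 posx sumn_rcons /=; apply/eqP; lia.
Qed.

Lemma size_block I w t :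
  size (block c I w t) = if t \in I then 1%N else (size (split_x (w t))).+2.
Proof. by rewrite /block; case: ifP => //= _; rewrite size_rcons. Qed.

Lemma split_box_inj N (d d' : split_box N) :
    split_i d = split_i d' -> split_j d = split_j d' -> split_x d = split_x d' ->
  d = d'.
Proof.
case: d d' => [[i j] x] [[i' j'] x']; rewrite /split_i /split_j /split_x /=.
move=> /val_inj-> /val_inj->.
by move=> /(inj_map val_inj)/val_inj->.
Qed.

(** The set I consists of the t whose block has length 1. There w has its dummy value; elsewhere j,
    x and i are the head, the middle and the last entry of the block. *)
Lemma block_inj I I' w w' :
    w \in splits c I -> w' \in splits c I' -> block c I w =1 block c I' w' ->
  (I, w) = (I', w').
Proof.
move=> /splitsP wP /splitsP wP' eqb.
have defI : I = I'.
  apply/setP => t; have := congr1 size (eqb t); rewrite !size_block.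
  by do 2 case: (t \in _).
rewrite -{}defI in wP' eqb *; congr pair; apply/ffunP => t.
move: (wP t) (wP' t) (eqb t); rewrite /block; case: ifP => [_ -> -> //|_ _ _].
by case=> eqj /rcons_inj[eqx eqi]; apply: split_box_inj.
Qed.

Lemma ex_split_box t b : b \in blocks (c t) ->
  exists d : split_box (bound c),
    if size b == 1%N then d = split0 (bound c) /\ b = [:: c t]
    else is_split (c t) (split_i d) (split_j d) (split_x d)
         /\ b = split_j d :: rcons (split_x d) (split_i d).
Proof.
rewrite mem_blocks //; case: b => // j x /= /and3P[j2 + /eqP def_c].
case/lastP: x def_c => [|x i] def_c posx.
  by exists (split0 (bound c)); rewrite /= -def_c addn0.
move: posx; rewrite all_rcons size_rcons /= => /andP[i1 posx].
have ijx : is_split (c t) i j x.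
  by rewrite /is_split i1 j2 posx -def_c sumn_rcons /=; apply/eqP; lia.
(* The box of size max c_t contains every solution for c_t. *)
have [d [di dj dx]] := is_split_bounded (leq_bigmax t) ijx.
by exists d; rewrite di dj dx.
Qed.

Lemma ex_splits (g : 'I_r -> seq nat) :
    (forall t, g t \in blocks (c t)) ->
  exists I, exists2 w, w \in splits c I & block c I w =1 g.
Proof.
move=> gP; have [d dP] := fin_all_exists (fun t => ex_split_box t (g t) (gP t)).
exists [set t | size (g t) == 1%N], [ffun t => d t].
  by apply/splitsP => t; rewrite inE ffunE; case: ifP (dP t) => _ [].
by move=> t; rewrite /block inE ffunE; case: ifP (dP t) => _ [].
Qed.

(** Taking blocks is a bijection: [block_inj] gives injectivity and [ex_splits] surjectivity. Both
    enumerations are free of duplicates and thus permutations of each other. *)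
Lemma sum_splits (Phi : seq (seq nat) -> rat) :
  \sum_(I : {set 'I_r}) \sum_(w in splits c I)
     Phi [seq block c I w t | t <- index_enum 'I_r]
  = \sum_(bs <- families (map c (index_enum 'I_r))) Phi bs.
Proof.
rewrite pair_big_dep /=.
pose bl (p : {set 'I_r} * {ffun 'I_r -> split_box (bound c)}) :=
  [seq block c p.1 p.2 t | t <- index_enum 'I_r].
pose valid := [pred p : {set 'I_r} * {ffun 'I_r -> split_box (bound c)} |
                 p.2 \in splits c p.1].
rewrite -(big_enum _ _ valid (Phi \o bl)) -(big_map bl xpredT Phi).
apply: perm_big; apply: uniq_perm.
- rewrite map_inj_in_uniq ?enum_uniq // => -[I w] [I' w'].
  rewrite !mem_enum => wP wP' /eq_in_map eqb; apply: block_inj => // t.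
  by apply: eqb; rewrite mem_index_enum.
- exact: families_uniq.
move=> bs; apply/mapP/idP => [[[I w]]|].
  rewrite mem_enum => wP ->; apply: families_map_mem => t _.
  exact: block_in_blocks.
case/mem_families_map; first exact: index_enum_uniq.
move=> g -> gP.
have [|I [w wP eqb]] := @ex_splits g.
  by move=> t; apply: gP; rewrite mem_index_enum.
by exists (I, w); rewrite ?mem_enum //; apply: eq_map => t; rewrite eqb.
Qed.

Lemma weight_block I w :
  weight [seq block c I w t | t <- index_enum 'I_r]
    = (#|~: I| + \sum_(t in ~: I) size (split_x (w t)))%N.
Proof.
rewrite /weight big_map -sum1_card -big_split [RHS]big_mkcond /=.
by apply: eq_bigr => t _; rewrite size_block inE; case: (t \in I).
Qed.

End Blocks.

Theorem theorem2p3 (n r : nat) (a : 'I_r.+1 -> nat) (c : 'I_r -> nat)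
    (n_gt0 : (0 < n)%N) (c_ge2 : forall t : 'I_r, (2 <= c t)%N) :
  Hstar n (arg_string a c) =
  2%:R * \sum_(I : {set 'I_r}) \sum_(w in splits c I)
    2%:R ^+ (#|~: I| + \sum_(t in ~: I) size (split_x (w t)))%N *
    \sum_(1 <= k < n.+1)
      H k.-1 (behead (kappa a c I w)) * A n k / k%:R ^+ head 0%N (kappa a c I w).
Proof.
pose aas := [seq a (widen_ord (leqnSn r) t) | t <- index_enum 'I_r].
pose cs := map c (index_enum 'I_r).
have -> : arg_string a c = twos_string (a ord_max) aas cs.
  by rewrite twos_string_map.
rewrite (represents_family (a ord_max) aas cs) ?size_map //; last first.
  by apply/allP => _ /mapP[t _ ->].
congr (_ * _); under eq_bigr do rewrite big_distrr /=.
(* With the sum over k moved inside, the families can be traded for the pairs (I, w). *)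
rewrite exchange_big -sum_splits //.
apply: eq_bigr => I _; apply: eq_bigr => w _.
rewrite weight_block big_distrr; apply: eq_bigr => k _ /=.
by rewrite glue_family_map /term -/(kappa a c I w); ring.
Qed.
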